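(* Let $1<a\le b$ be natural numbers and let $0<q<1$. Then $$ \begin{aligned} \bar{\mathfrak{z}}_q(a)\,\bar{\mathfrak{z}}_q(b) ={}& \sum_{l=0}^{a-1}\ \sum_{k=0}^{a-1-l} (-1)^k \binom{l+b-1}{b-1}\binom{b}{k}\, \bar{\mathfrak{z}}_q(b+l,a-l-k)\\ &+ \sum_{l=0}^{b-1}\ \sum_{k=0}^{\min(a,b-1-l)} (-1)^k \binom{l+a-1}{a-1}\binom{a}{k}\, \bar{\mathfrak{z}}_q(a+l,b-l-k)\\ &- \sum_{k=1}^{a} \beta_{a-k}\, \bar{\mathfrak{z}}_q(a+b-k) + \sum_{j=1}^{a-1} \alpha_{a+b-1-j}\, \delta \bar{\mathfrak{z}}_q(a+b-1-j), \end{aligned} $$ where $$ \beta_j = (-1)^{a-j}\binom{j+b-1}{j,\ j+b-a,\ a-j-1}\quad (0\le j\le a-1), $$ $$ \alpha_k = \sum_{j=b}^{k} \frac{(-1)^{a+b-j}}{1-j}\binom{j-1}{j-b,\ j-a,\ a+b-j-1}\quad (b\le k\le a+b-2). $$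
   Context: For positive integers $n_1,\dots,n_k$ with $n_1>1$, define $$\bar{\mathfrak{z}}_q(n_1,\ldots,n_k) := \sum_{m_1>\dots>m_k>0} \frac{q^{m_1}}{(1-q^{m_1})^{n_1}\cdots(1-q^{m_k})^{n_k}}.$$ The derivation $\delta := q\frac{d}{dq}$ acts on these series viewed as functions of $q$. The multinomial coefficient is $\binom{n}{r,s,t}=\frac{n!}{r!\,s!\,t!}$ for nonnegative integers with $r+s+t=n$. *)

(* Defs.v *)
From Stdlib Require Import Reals List Factorial.
From Coquelicot Require Import Coquelicot.

Open Scope R_scope.

(* [sum_n_m f i j] is the sum of [f k] over i <= k <= j, and is 0 when j < i. *)

(* zbar_trunc [n_1; ...; n_k] q M is the finite sum over M > m_1 > ... > m_k > 0
   of 1 / ((1 - q^m_1)^n_1 ... (1 - q^m_k)^n_k). *)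
Fixpoint zbar_trunc (ns : list nat) (q : R) (M : nat) : R :=
  match ns with
  | nil => 1
  | cons n ns' =>
      sum_n_m (fun m => / (1 - q ^ m) ^ n * zbar_trunc ns' q m) 1 (M - 1)
  end.

(* zbar n_1 [n_2; ...; n_k] q is the depth k series with arguments n_1, ..., n_k:
   the infinite sum runs over m_1 = i + 1, the inner sums are finite. *)
Definition zbar (n1 : nat) (ns : list nat) (q : R) : R :=
  Series (fun i : nat =>
    let m := S i in q ^ m / (1 - q ^ m) ^ n1 * zbar_trunc ns q m).

Definition qderiv (f : R -> R) (q : R) : R := q * Derive f q.

(* Only meaningful when r + s + t = n. *)
Definition multinomial (n r s t : nat) : R :=
  INR (fact n) / (INR (fact r) * INR (fact s) * INR (fact t)).

(* The binomial coefficient, which the name [C] denotes in Stdlib; Coquelicot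
   rebinds [C] to the complex numbers. It is the usual coefficient only for
   k <= n. *)
Definition binom (n k : nat) : R := Binomial.C n k.

Definition beta (a b j : nat) : R :=
  (-1) ^ (a - j) * multinomial (j + b - 1) j (j + b - a) (a - j - 1).

Definition alpha (a b k : nat) : R :=
  sum_n_m (fun j =>
    (-1) ^ (a + b - j) / (1 - INR j)
      * multinomial (j - 1) (j - b) (j - a) (a + b - j - 1)) b k.

(* Main.v *)
Require Import Defs.
From Stdlib Require Import Reals List Factorial Lra Lia.
From Coquelicot Require Import Coquelicot.

Open Scope R_scope.

(** Put [u = 1/(1 - q^m)], [v = 1/(1 - q^n)] and [w = 1/(1 - q^(m+n))]. The
    product of the two series is the sum of [q^(m+n) u^a v^b] over [m, n > 0],
    and the three quantities satisfy [u v = w (u + v - 1)], the q-analogue of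
    [1/(m n) = (1/m + 1/n)/(m + n)]. This relation gives a partial fraction
    decomposition ([partial_fractions]) of [u^a v^b] into monomials [w^s u^r],
    [w^s v^r] with [r > 0], and [w^s]. Summed over [m + n = m_1], a monomial
    [w^s u^r] produces the depth two value [zbar s [r]], because the constraint
    is [m_1 > m > 0]; these are the two double sums of the theorem.

    A monomial [w^s] is counted once for each of the [m_1 - 1] splittings of
    [m_1]. The [-1] produces the values [zbar (a + b - k)], with coefficients
    [beta] ([w_part_beta]). The factor [m_1] produces sums of [m_1 q^(m_1) w^s].
    Since [delta zbar(n)] is the sum of [m q^m ((1 - n) w^n + n w^(n+1))]
    ([is_series_qderiv]), what remains is to write the polynomial with
    coefficients [beta] as a combination of the [(1 - n) w^n + n w^(n+1)]. The
    coefficients [alpha] solve the resulting two-term recursion; there is one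
    equation more than there are unknowns, and it holds thanks to the closed
    form of [alpha_closed] ([alpha_beta_sum]).

    The decomposition itself comes from a recursion: the relation yields
    [X(a+1, b+1) = w (X(a, b+1) + X(a+1, b) - X(a, b))] for [X(a, b) = u^a v^b],
    and each of the three parts satisfies the same recursion. *)

(** * Finite sums *)

(** Equations between values of [sum_n_m] live in the carrier of an abelian
    monoid that is only convertible to [R], which [ring] and [field] reject. *)
Ltac eq_R := match goal with |- ?x = ?y => change (@eq R x y) end.
Ltac ring_R := eq_R; ring.

Lemma sum_n_m_scal_R (c : R) (f : nat -> R) (n m : nat) :
  c * sum_n_m f n m = sum_n_m (fun k => c * f k) n m.
Proof. symmetry; exact (sum_n_m_mult_l (K := R_Ring) c f n m). Qed.

Lemma sum_n_m_plus_R (f g : nat -> R) (n m : nat) :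
  sum_n_m f n m + sum_n_m g n m = sum_n_m (fun k => f k + g k) n m.
Proof. symmetry; exact (sum_n_m_plus (G := R_AbelianMonoid) f g n m). Qed.

Lemma sum_n_m_first (f : nat -> R) (n m : nat) :
  (n <= m)%nat -> sum_n_m f n m = f n + sum_n_m f (S n) m.
Proof. exact (sum_Sn_m (G := R_AbelianMonoid) f n m). Qed.

Lemma sum_n_m_last (f : nat -> R) (n m : nat) :
  (n <= S m)%nat -> sum_n_m f n (S m) = sum_n_m f n m + f (S m).
Proof. exact (sum_n_Sm (G := R_AbelianMonoid) f n m). Qed.

Lemma sum_n_m_ext_in (f g : nat -> R) (n m : nat) :
  (forall k, (n <= k <= m)%nat -> f k = g k) -> sum_n_m f n m = sum_n_m g n m.
Proof. exact (sum_n_m_ext_loc (G := R_AbelianMonoid) f g n m). Qed.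

Lemma sum_n_m_empty (f : nat -> R) (n m : nat) :
  (m < n)%nat -> sum_n_m f n m = 0.
Proof. exact (sum_n_m_zero (G := R_AbelianMonoid) f n m). Qed.

Lemma sum_n_m_shift (f : nat -> R) (n m : nat) :
  sum_n_m f (S n) (S m) = sum_n_m (fun k => f (S k)) n m.
Proof. symmetry; exact (sum_n_m_S (G := R_AbelianMonoid) f n m). Qed.

Lemma sum_n_m_truncate (f : nat -> R) (m N : nat) :
  (m <= N)%nat -> (forall k, (m < k <= N)%nat -> f k = 0) ->
  sum_n_m f 0 N = sum_n_m f 0 m.
Proof.
  induction N as [|N IH]; intros Hm Hf.
  - now replace m with 0%nat by lia.
  - destruct (Nat.eq_dec m (S N)) as [->|Hne]; [reflexivity|].
    rewrite sum_n_m_last, Hf, IH by (lia || (intros; apply Hf; lia)). ring_R.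
Qed.

Lemma sum_n_m_reverse (f : nat -> R) (N : nat) :
  sum_n_m f 0 N = sum_n_m (fun k => f (N - k)%nat) 0 N.
Proof.
  induction N as [|N IH] in f |- *; [reflexivity|].
  rewrite sum_n_m_first, sum_n_m_shift, IH, sum_n_m_last by lia.
  rewrite Nat.sub_diag, Rplus_comm. f_equal.
  apply sum_n_m_ext_in; intros k Hk. f_equal; lia.
Qed.

Lemma sum_n_m_exchange (f : nat -> nat -> R) (n m n' m' : nat) :
  sum_n_m (fun i => sum_n_m (f i) n' m') n m =
  sum_n_m (fun j => sum_n_m (fun i => f i j) n m) n' m'.
Proof.
  induction m as [|m IH].
  - destruct n.
    + rewrite sum_n_n. apply sum_n_m_ext_in; intros; now rewrite sum_n_n.
    + rewrite sum_n_m_empty by lia.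
      rewrite (sum_n_m_ext_in _ (fun _ => 0)) by (intros; apply sum_n_m_empty; lia).
      symmetry; exact (sum_n_m_const_zero (G := R_AbelianMonoid) n' m').
  - destruct (Nat.le_gt_cases n (S m)) as [H|H].
    + rewrite sum_n_m_last, IH, sum_n_m_plus_R by lia.
      apply sum_n_m_ext_in; intros; now rewrite sum_n_m_last.
    + rewrite sum_n_m_empty by lia.
      rewrite (sum_n_m_ext_in _ (fun _ => 0)) by (intros; apply sum_n_m_empty; lia).
      symmetry; exact (sum_n_m_const_zero (G := R_AbelianMonoid) n' m').
Qed.

(** * Binomial coefficients *)

(** Unlike [binom], this vanishes for [k > n], so that Pascal's rule has no
    exceptions at the ends of the summation ranges. *)
Fixpoint choose (n k : nat) : R :=
  match n, k with
  | _, 0%nat => 1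
  | 0%nat, S _ => 0
  | S n', S k' => choose n' k' + choose n' (S k')
  end.

Lemma choose_0_r (n : nat) : choose n 0 = 1.
Proof. now destruct n. Qed.

Lemma choose_gt (n k : nat) : (n < k)%nat -> choose n k = 0.
Proof.
  induction n as [|n IH] in k |- *; destruct k; intros; try lia; [easy|].
  simpl. rewrite !IH by lia. ring_R.
Qed.

Lemma choose_binom (n k : nat) : (k <= n)%nat -> choose n k = binom n k.
Proof.
  unfold binom. induction n as [|n IH] in k |- *; intros Hk.
  - replace k with 0%nat by lia. now rewrite C_n_0.
  - destruct k as [|k]; [now rewrite C_n_0|]. simpl.
    destruct (Nat.eq_dec k n) as [->|Hne].
    + rewrite (choose_gt n (S n)), IH, !C_n_n by lia. ring_R.
    + rewrite !IH by lia. apply pascal. lia.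
Qed.

Lemma choose_fact (n k : nat) :
  (k <= n)%nat -> choose n k = INR (fact n) / (INR (fact k) * INR (fact (n - k))).
Proof. exact (choose_binom n k). Qed.

(** * Convolutions *)

Definition conv (f g : nat -> R) (n : nat) : R :=
  sum_n_m (fun l => f l * g (n - l)%nat) 0 n.

(** For generating functions [G], [H] with coefficients [g], [h], this says
    [H = (1 - c t) G]. *)
Definition times_one_minus (c : R) (g h : nat -> R) : Prop :=
  h 0%nat = g 0%nat /\ forall n, h (S n) = g (S n) - c * g n.

Lemma conv_comm (f g : nat -> R) (n : nat) : conv f g n = conv g f n.
Proof.
  unfold conv. rewrite sum_n_m_reverse. apply sum_n_m_ext_in; intros k Hk.
  replace (n - (n - k))%nat with k by lia. apply Rmult_comm.
Qed.

Lemma conv_delta (f g : nat -> R) (n : nat) :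
  f 0%nat = 1 -> (forall l, f (S l) = 0) -> conv f g n = g n.
Proof.
  intros H0 HS. unfold conv.
  rewrite (sum_n_m_truncate _ 0 n), sum_n_n, H0, Nat.sub_0_r by
    (lia || (intros [|k] Hk; [lia | rewrite HS; ring_R])).
  ring_R.
Qed.

Lemma times_one_minus_conv_l (c : R) (g h f : nat -> R) :
  times_one_minus c g h -> times_one_minus c (conv g f) (conv h f).
Proof.
  intros [H0 HS]. split; [unfold conv; rewrite !sum_n_n; now rewrite H0|].
  intros n. unfold conv.
  rewrite (sum_n_m_first _ 0 (S n)), sum_n_m_shift by lia.
  rewrite (sum_n_m_first (fun l => g l * _) 0 (S n)), sum_n_m_shift by lia.
  rewrite H0, sum_n_m_scal_R.
  set (A := g 0%nat * _). unfold Rminus. rewrite Rplus_assoc. f_equal.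
  rewrite <- (Rmult_1_l (sum_n_m (fun k => c * _) _ _)), Ropp_mult_distr_l.
  rewrite sum_n_m_scal_R, sum_n_m_plus_R.
  apply sum_n_m_ext_in; intros k Hk. rewrite HS. simpl. ring_R.
Qed.

Lemma times_one_minus_conv_r (c : R) (f g h : nat -> R) :
  times_one_minus c g h -> times_one_minus c (conv f g) (conv f h).
Proof.
  intros H. destruct (times_one_minus_conv_l c g h f H) as [H0 HS].
  split; intros; rewrite !(conv_comm f); auto.
Qed.

(** * Partial fractions *)

(** The coefficient of [t^l] in [(w / (1 - w t))^b]; for [b = 0] the truncated
    subtraction still gives the power series 1. *)
Definition geom_pow_coef (w : R) (b l : nat) : R := choose (l + b - 1) l * w ^ (b + l).

(** The coefficient of [t^k] in [(1 - t)^b]. *)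
Definition one_minus_pow_coef (b k : nat) : R := (-1) ^ k * choose b k.

(** The coefficient of [t^r] in [u t / (1 - u t)]. *)
Definition pos_powers (u : R) (r : nat) : R :=
  match r with 0%nat => 0 | S _ => u ^ r end.

(** Solving [u v = w (u + v - 1)] for [v] gives [v = w (1 - 1/u) / (1 - w/u)].
    Hence, for fixed [w], the terms of positive degree in [u] of [u^a v^b],
    expanded at [u = oo], have the coefficient of [t^a] in
    [(w / (1 - w t))^b (1 - t)^b (u t / (1 - u t))] as their sum. *)
Definition polar (u w : R) (a b : nat) : R :=
  conv (geom_pow_coef w b) (conv (one_minus_pow_coef b) (pos_powers u)) a.

Lemma geom_pow_coef_step (w : R) (b : nat) :
  times_one_minus w (geom_pow_coef w (S b)) (fun l => w * geom_pow_coef w b l).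
Proof.
  unfold geom_pow_coef. split.
  - rewrite !choose_0_r, Nat.add_0_r, Nat.add_0_r. simpl. ring_R.
  - intros l. replace (S l + S b - 1)%nat with (S (l + b)) by lia.
    replace (l + S b - 1)%nat with (l + b)%nat by lia.
    replace (S l + b - 1)%nat with (l + b)%nat by lia.
    replace (S b + S l)%nat with (S (S (b + l))) by lia.
    replace (S b + l)%nat with (S (b + l)) by lia.
    replace (b + S l)%nat with (S (b + l)) by lia. simpl. ring_R.
Qed.

Lemma one_minus_pow_coef_step (b : nat) :
  times_one_minus 1 (one_minus_pow_coef b) (one_minus_pow_coef (S b)).
Proof.
  unfold one_minus_pow_coef. split; [now rewrite !choose_0_r|]. intros k. simpl. ring_R.
Qed.

(** The power series [(1 - w t)^(-b)] and [(1 - t)^b] pass to the exponent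
    [b + 1] by the factors [1 / (1 - w t)] and [1 - t]. *)
Lemma polar_step (u w : R) (a b : nat) :
  polar u w (S a) (S b) =
  w * (polar u w a (S b) + polar u w (S a) b - polar u w a b).
Proof.
  unfold polar.
  destruct (times_one_minus_conv_l _ _ _ (conv (one_minus_pow_coef (S b)) (pos_powers u))
    (geom_pow_coef_step w b)) as [_ H1].
  destruct (times_one_minus_conv_r _ (geom_pow_coef w b) _ _
    (times_one_minus_conv_l _ _ _ (pos_powers u) (one_minus_pow_coef_step b))) as [_ H2].
  specialize (H1 a). specialize (H2 a). rewrite Rmult_1_l in H2.
  assert (E : conv (fun l => w * geom_pow_coef w b l)
      (conv (one_minus_pow_coef (S b)) (pos_powers u)) (S a) =
    w * conv (geom_pow_coef w b) (conv (one_minus_pow_coef (S b)) (pos_powers u)) (S a)).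
  { unfold conv at 1 3. rewrite sum_n_m_scal_R.
    apply sum_n_m_ext_in; intros; ring_R. }
  rewrite E, H2 in H1. lra.
Qed.

Lemma polar_0_l (u w : R) (b : nat) : polar u w 0 b = 0.
Proof. unfold polar, conv. rewrite !sum_n_n. simpl. ring_R. Qed.

Lemma polar_0_r (u w : R) (a : nat) : polar u w a 0 = pos_powers u a.
Proof.
  unfold polar. rewrite conv_delta; [apply conv_delta | |].
  - unfold one_minus_pow_coef. simpl. ring_R.
  - intros l. unfold one_minus_pow_coef. simpl. ring_R.
  - unfold geom_pow_coef. simpl. ring_R.
  - intros l. unfold geom_pow_coef. rewrite choose_gt by lia. ring_R.
Qed.

(** The inner sum stops at [b] since [(1 - t)^b] has degree [b], and before
    [k = a - l] since only positive powers of [u] occur. *)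
Lemma polar_expand (u w : R) (a b : nat) : (1 <= a)%nat ->
  polar u w a b =
  sum_n_m (fun l =>
    sum_n_m (fun k =>
      (-1) ^ k * choose (l + b - 1) l * choose b k
        * (w ^ (b + l) * u ^ (a - l - k)))
      0 (Nat.min b (a - 1 - l))) 0 (a - 1).
Proof.
  intros Ha. unfold polar. unfold conv at 1.
  rewrite (sum_n_m_truncate _ (a - 1)).
  - apply sum_n_m_ext_in; intros l Hl. unfold conv.
    rewrite (sum_n_m_truncate _ (Nat.min b (a - 1 - l))).
    + rewrite sum_n_m_scal_R. apply sum_n_m_ext_in; intros k Hk.
      unfold geom_pow_coef, one_minus_pow_coef, pos_powers.
      destruct (a - l - k)%nat eqn:E; [lia|]. ring_R.
    + lia.
    + intros k Hk. unfold one_minus_pow_coef. destruct (Nat.le_gt_cases k b) as [H|H].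
      * replace (a - l - k)%nat with 0%nat by lia. simpl; ring_R.
      * rewrite choose_gt by lia. ring_R.
  - lia.
  - intros k Hk. replace (a - k)%nat with 0%nat by lia.
    unfold conv. rewrite sum_n_n. simpl. ring_R.
Qed.

(** * The monomials in w alone *)

(** The product of the two values of [choose] is the multinomial coefficient
    [(a+b-t)! / (t! (a-t)! (b-t)!)], and it vanishes for [t > a] or
    [t > b]. Summation over [t] gives a weighted Delannoy number: lattice paths
    with horizontal and vertical steps of weight [w] and diagonal steps of
    weight [- w]. *)
Definition delannoy_term (w : R) (a b t : nat) : R :=
  (-1) ^ t * (choose (a + b - t) a * choose a t) * w ^ (a + b - t).

Definition delannoy (w : R) (a b : nat) : R :=
  sum_n_m (delannoy_term w a b) 0 a.

Lemma delannoy_0_l (w : R) (b : nat) : delannoy w 0 b = w ^ b.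
Proof.
  unfold delannoy, delannoy_term. rewrite sum_n_n, Nat.sub_0_r.
  simpl. rewrite choose_0_r. ring_R.
Qed.

Lemma delannoy_0_r (w : R) (a : nat) : delannoy w a 0 = w ^ a.
Proof.
  unfold delannoy. rewrite (sum_n_m_truncate _ 0), sum_n_n.
  - unfold delannoy_term. rewrite Nat.sub_0_r, Nat.add_0_r, choose_0_r.
    rewrite choose_binom by lia. unfold binom. rewrite C_n_n. simpl. ring_R.
  - lia.
  - intros k Hk. unfold delannoy_term.
    rewrite (choose_gt (a + 0 - k)) by lia. ring_R.
Qed.

(** The last step of a lattice path is horizontal, vertical or diagonal. *)
Lemma delannoy_step (w : R) (a b : nat) :
  delannoy w (S a) (S b) =
  w * (delannoy w a (S b) + delannoy w (S a) b - delannoy w a b).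
Proof.
  unfold delannoy. rewrite (sum_n_m_first _ 0 (S a)), sum_n_m_shift by lia.
  rewrite (sum_n_m_first (delannoy_term w (S a) b) 0 (S a)), sum_n_m_shift by lia.
  rewrite <- (sum_n_m_truncate (delannoy_term w a (S b)) a (S a)) by
    (lia || (intros; unfold delannoy_term; rewrite (choose_gt a) by lia; ring_R)).
  rewrite (sum_n_m_first (delannoy_term w a (S b)) 0 (S a)), sum_n_m_shift by lia.
  assert (E0 : delannoy_term w (S a) (S b) 0 =
    w * (delannoy_term w a (S b) 0 + delannoy_term w (S a) b 0)).
  { unfold delannoy_term. rewrite !Nat.sub_0_r, !choose_0_r.
    replace (a + S b)%nat with (S (a + b)) by lia.
    replace (S a + S b)%nat with (S (S (a + b))) by lia.
    replace (S a + b)%nat with (S (a + b)) by lia.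
    change (choose (S (S (a + b))) (S a)) with
      (choose (S (a + b)) a + choose (S (a + b)) (S a)).
    simpl (_ ^ _). ring_R. }
  rewrite E0.
  assert (ES : sum_n_m (fun k => delannoy_term w (S a) (S b) (S k)) 0 a =
    w * (sum_n_m (fun k => delannoy_term w a (S b) (S k)) 0 a
       + sum_n_m (fun k => delannoy_term w (S a) b (S k)) 0 a
       + (-1) * sum_n_m (delannoy_term w a b) 0 a)).
  { rewrite (sum_n_m_scal_R (-1)), !sum_n_m_plus_R, sum_n_m_scal_R.
    apply sum_n_m_ext_in; intros t Ht. unfold delannoy_term.
    replace (a + S b - S t)%nat with (a + b - t)%nat by lia.
    replace (S a + S b - S t)%nat with (S (a + b - t)) by lia.
    replace (S a + b - S t)%nat with (a + b - t)%nat by lia.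
    change (choose (S (a + b - t)) (S a)) with
      (choose (a + b - t) a + choose (a + b - t) (S a)).
    change (choose (S a) (S t)) with (choose a t + choose a (S t)).
    simpl (_ ^ _). ring_R. }
  rewrite ES. ring_R.
Qed.

(** The values at the boundary are those that [u^a v^b] leaves after the polar
    parts; the recursion turns the value 1 at the origin into [- w] at [(1, 1)],
    from which the Delannoy recursion starts. *)
Definition w_part (w : R) (a b : nat) : R :=
  match a, b with
  | 0%nat, 0%nat => 1
  | S a', S b' => - w * delannoy w a' b'
  | _, _ => 0
  end.

Lemma w_part_step (w : R) (a b : nat) :
  w_part w (S a) (S b) =
  w * (w_part w a (S b) + w_part w (S a) b - w_part w a b).
Proof.
  destruct a as [|a], b as [|b]; simpl w_part;
    rewrite ?delannoy_0_l, ?delannoy_0_r, ?delannoy_step; simpl; ring_R.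
Qed.

(** All terms satisfy the same recursion in [(a, b)], so comparing them for
    [a = 0] and for [b = 0] is enough. *)
Lemma partial_fractions (u v w : R) (a b : nat) :
  u * v = w * (u + v - 1) ->
  u ^ a * v ^ b = polar u w a b + polar v w b a + w_part w a b.
Proof.
  intros Huv. induction a as [|a IHa] in b |- *.
  - rewrite polar_0_l, polar_0_r. destruct b; simpl; ring_R.
  - induction b as [|b IHb].
    + rewrite polar_0_l, polar_0_r. simpl; ring_R.
    + transitivity (w * (u ^ a * v ^ S b + u ^ S a * v ^ b - u ^ a * v ^ b)).
      * simpl. transitivity (u * v * (u ^ a * v ^ b)); [ring_R|].
        rewrite Huv. ring_R.
      * rewrite IHb, !IHa, (polar_step u), (polar_step v), w_part_step. ring_R.
Qed.

Lemma w_part_beta (w : R) (a b : nat) : (1 <= a <= b)%nat ->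
  w_part w a b = sum_n_m (fun k => beta a b (a - k) * w ^ (a + b - k)) 1 a.
Proof.
  intros Hab. destruct a as [|a]; [lia|]. destruct b as [|b]; [lia|].
  rewrite sum_n_m_shift. simpl w_part. unfold delannoy.
  rewrite sum_n_m_scal_R. apply sum_n_m_ext_in; intros t Ht.
  unfold delannoy_term, beta, multinomial.
  rewrite !choose_fact by lia.
  replace (S a - (S a - S t))%nat with (S t) by lia.
  replace (S a - S t + S b - 1)%nat with (a + b - t)%nat by lia.
  replace (S a - S t)%nat with (a - t)%nat by lia.
  replace (a - t + S b - S a)%nat with (b - t)%nat by lia.
  replace (S t - 1)%nat with t by lia.
  replace (S a + S b - S t)%nat with (S (a + b - t)) by lia.
  replace (a + b - t - a)%nat with (b - t)%nat by lia.
  simpl (_ ^ _). eq_R. field. repeat split; apply INR_fact_neq_0.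
Qed.

(** * The coefficients of the derivatives *)

(** The sum defining [alpha] telescopes: with
    [t_j = (-1)^j (j-2)! / ((j-b)! (j-a)! (a+b-1-j)!)] and
    [T_j = (j-a) (j-b) t_j], one has [T_(j+1) - T_j = - (a-1) (b-1) t_j]. *)
Lemma alpha_closed (a b i : nat) : (1 < a <= b)%nat -> (i <= a - 2)%nat ->
  alpha a b (b + i) =
  - (-1) ^ (a - i) * INR (fact (b + i - 1))
    / (INR (a - 1) * INR (b - 1) * INR (fact i) * INR (fact (b + i - a))
       * INR (fact (a - 2 - i))).
Proof.
  intros Hab Hi. unfold alpha.
  induction i as [|i IH].
  - rewrite Nat.add_0_r, sum_n_n. unfold multinomial.
    replace (a + b - b)%nat with a by lia. rewrite !Nat.sub_diag, !Nat.sub_0_r.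
    destruct a as [|[|a]]; [lia..|]. destruct b as [|[|b]]; [lia..|].
    replace (S (S a) + S (S b) - S (S b) - 1)%nat with (S a) by lia.
    replace (S (S a) - 2)%nat with a by lia.
    replace (S (S a) - 1)%nat with (S a) by lia.
    replace (S (S b) - 1)%nat with (S b) by lia.
    change (fact (S a)) with (S a * fact a)%nat.
    rewrite (S_INR (S b)), mult_INR.
    change (INR (fact 0)) with 1.
    pose proof (INR_fact_neq_0 a). pose proof (INR_fact_neq_0 (S (S b) - S (S a))).
    assert (INR (S a) <> 0) by now apply not_0_INR.
    assert (INR (S b) <> 0) by now apply not_0_INR.
    eq_R.
    field. repeat split; auto. lra.
  - rewrite Nat.add_succ_r, sum_n_m_last, IH by lia. clear IH. unfold multinomial.
    (* Write [a = i + e + 3] and [b = c + a]: no subtraction is then truncated. *)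
    destruct (Nat.le_exists_sub (S i) (a - 2) Hi) as [e [He _]].
    destruct (Nat.le_exists_sub a b) as [c [-> _]]; [lia|].
    replace a with (S (S (S (i + e)))) in * by lia. clear He Hi.
    replace (c + S (S (S (i + e))) + i - 1)%nat with (c + i + i + e + 2)%nat by lia.
    replace (S (c + S (S (S (i + e))) + i) - 1)%nat
      with (S (c + i + i + e + 2)) by lia.
    replace (c + S (S (S (i + e))) + i - S (S (S (i + e))))%nat
      with (c + i)%nat by lia.
    replace (S (c + S (S (S (i + e))) + i) - S (S (S (i + e))))%nat
      with (S (c + i))%nat by lia.
    replace (S (c + S (S (S (i + e))) + i) - (c + S (S (S (i + e)))))%nat
      with (S i) by lia.
    replace (S (S (S (i + e))) + (c + S (S (S (i + e))))
      - S (c + S (S (S (i + e))) + i))%nat with (S (S e)) by lia.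
    replace (S (S (S (i + e))) - i)%nat with (S (S (S e))) by lia.
    replace (S (S (S (i + e))) - S i)%nat with (S (S e)) by lia.
    replace (S (S e) - 1)%nat with (S e) by lia.
    replace (S (S (S (i + e))) - 1)%nat with (S (S (i + e))) by lia.
    replace (S (S (S (i + e))) - 2 - i)%nat with (S e) by lia.
    replace (S (S (S (i + e))) - 2 - S i)%nat with e by lia.
    replace (c + S (S (S (i + e))) - 1)%nat with (S (S (c + i + e))) by lia.
    replace (S (c + S (S (S (i + e))) + i))%nat
      with (S (S (c + i + i + e + 2))) by lia.
    rewrite !fact_simpl, !mult_INR, !S_INR, !plus_INR.
    change (INR 2) with 2.
    pose proof (INR_fact_neq_0 e). pose proof (INR_fact_neq_0 i).
    pose proof (INR_fact_neq_0 (c + i)).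
    pose proof (pos_INR e). pose proof (pos_INR i). pose proof (pos_INR c).
    simpl (_ ^ _).
    eq_R.
    field. repeat split; auto; lra.
Qed.

Lemma abel_summation (al x : nat -> R) (b N : nat) :
  sum_n_m (fun i => al i * ((1 - INR (b + i)) * x i + INR (b + i) * x (S i))) 0 N =
  (1 - INR b) * al 0%nat * x 0%nat
  + sum_n_m (fun i => (1 - INR (b + i)) * (al i - al (i - 1)%nat) * x i) 1 N
  + INR (b + N) * al N * x (S N).
Proof.
  induction N as [|N IH].
  - rewrite sum_n_n, sum_n_m_empty, Nat.add_0_r by lia. ring_R.
  - rewrite !sum_n_m_last, IH by lia.
    replace (S N - 1)%nat with N by lia.
    rewrite Nat.add_succ_r, S_INR. ring_R.
Qed.

Lemma beta_alpha_first (a b : nat) : (1 < a <= b)%nat ->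
  beta a b 0 = (1 - INR b) * alpha a b b.
Proof.
  intros Hab. unfold alpha, beta. rewrite sum_n_n.
  rewrite Nat.sub_diag, Nat.add_sub, !Nat.sub_0_r. simpl (0 + b)%nat.
  assert (INR 1 < INR b) by (apply lt_INR; lia). simpl (INR 1) in *.
  eq_R.
  field. lra.
Qed.

Lemma beta_alpha_diff (a b i : nat) : (1 < a <= b)%nat -> (1 <= i <= a - 2)%nat ->
  beta a b i = (1 - INR (b + i)) * (alpha a b (b + i) - alpha a b (b + (i - 1))).
Proof.
  intros Hab Hi. destruct i as [|i]; [lia|].
  rewrite Nat.add_succ_r. simpl (S i - 1)%nat. rewrite Nat.sub_0_r.
  unfold alpha, beta. rewrite sum_n_m_last by lia.
  replace (a + b - S (b + i))%nat with (a - S i)%nat by lia.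
  replace (S i + b - 1)%nat with (S (b + i) - 1)%nat by lia.
  replace (S (b + i) - b)%nat with (S i) by lia.
  replace (S i + b - a)%nat with (S (b + i) - a)%nat by lia.
  assert (INR 1 < INR (S (b + i))) by (apply lt_INR; lia). simpl (INR 1) in *.
  eq_R.
  field. lra.
Qed.

(** Equivalent to the vanishing of the sum defining [alpha] when it is extended
    by one term to [j = a + b - 1]. *)
Lemma beta_alpha_last (a b : nat) : (1 < a <= b)%nat ->
  beta a b (a - 1) = INR (b + (a - 2)) * alpha a b (b + (a - 2)).
Proof.
  intros Hab. rewrite alpha_closed by lia. unfold beta, multinomial.
  destruct (Nat.le_exists_sub a b) as [c [-> _]]; [lia|].
  destruct a as [|[|a]]; [lia..|].
  replace (S (S a) - 1)%nat with (S a) by lia.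
  replace (S (S a) - 2)%nat with a by lia.
  replace (S (S a) - S a)%nat with 1%nat by lia.
  replace (S (S a) - a)%nat with 2%nat by lia.
  replace (S a + (c + S (S a)) - 1)%nat with (S (c + a + a + 1)) by lia.
  replace (S a + (c + S (S a)) - S (S a))%nat with (S (c + a)) by lia.
  replace (c + S (S a) + a - 1)%nat with (c + a + a + 1)%nat by lia.
  replace (c + S (S a) + a - S (S a))%nat with (c + a)%nat by lia.
  replace (c + S (S a) + a)%nat with (S (c + a + a + 1)) by lia.
  replace (c + S (S a) - 1)%nat with (S (c + a)) by lia.
  rewrite !Nat.sub_diag, !fact_simpl, !mult_INR, !S_INR, !plus_INR.
  change (INR (fact 0)) with 1. change (INR 1) with 1.
  pose proof (INR_fact_neq_0 a). pose proof (INR_fact_neq_0 (c + a)).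
  pose proof (pos_INR a). pose proof (pos_INR c).
  field. repeat split; auto; lra.
Qed.

Lemma alpha_beta_sum (w : R) (a b : nat) : (1 < a <= b)%nat ->
  sum_n_m (fun j => alpha a b (a + b - 1 - j) *
    ((1 - INR (a + b - 1 - j)) * w ^ (a + b - 1 - j)
      + INR (a + b - 1 - j) * w ^ S (a + b - 1 - j))) 1 (a - 1)
  = sum_n_m (fun k => beta a b (a - k) * w ^ (a + b - k)) 1 a.
Proof.
  intros Hab.
  transitivity (sum_n_m (fun i => alpha a b (b + i) *
    ((1 - INR (b + i)) * w ^ (b + i) + INR (b + i) * w ^ (b + S i))) 0 (a - 2)).
  { replace (a - 1)%nat with (S (a - 2)) by lia.
    rewrite sum_n_m_shift, sum_n_m_reverse.
    apply sum_n_m_ext_in; intros i Hi.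
    replace (a + b - 1 - S (a - 2 - i))%nat with (b + i)%nat by lia.
    now rewrite Nat.add_succ_r. }
  transitivity (sum_n_m (fun i => beta a b i * w ^ (b + i)) 0 (a - 1)).
  2:{ destruct a as [|a]; [lia|]. replace (S a - 1)%nat with a by lia.
    rewrite sum_n_m_shift, sum_n_m_reverse.
    apply sum_n_m_ext_in; intros i Hi.
    replace (S a - S i)%nat with (a - i)%nat by lia. f_equal. f_equal. lia. }
  rewrite (abel_summation (fun i => alpha a b (b + i)) (fun i => w ^ (b + i))).
  replace (a - 1)%nat with (S (a - 2)) by lia.
  rewrite (sum_n_m_first _ 0 (S (a - 2))), sum_n_m_last by lia.
  replace (S (a - 2)) with (a - 1)%nat by lia.
  rewrite Nat.add_0_r, beta_alpha_first, beta_alpha_last by lia.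
  rewrite (sum_n_m_ext_in (fun i => beta a b i * _) (fun i =>
    (1 - INR (b + i)) * (alpha a b (b + i) - alpha a b (b + (i - 1))) * w ^ (b + i))).
  - ring_R.
  - intros i Hi. now rewrite beta_alpha_diff by lia.
Qed.

(** * Differentiation of series *)

(** The Weierstrass M-test. *)
Lemma CVU_dom_series (f : nat -> R -> R) (M : nat -> R) (D : R -> Prop) :
  (forall i x, D x -> Rabs (f i x) <= M i) -> ex_series M ->
  CVU_dom (fun n x => sum_n (fun i => f i x) n) D.
Proof.
  intros Hf HM. apply CVU_dom_cauchy. intros eps.
  destruct (Cauchy_ex_series M HM eps) as [N HN]. exists N.
  assert (Hlt : forall n m x, D x -> (N <= n)%nat -> (n <= m)%nat ->
    Rabs (sum_n (fun i => f i x) m - sum_n (fun i => f i x) n) < eps).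
  { intros n m x Hx Hn Hm.
    replace (sum_n (fun i => f i x) m - sum_n (fun i => f i x) n)
      with (sum_n_m (fun i => f i x) (S n) m)
      by exact (sum_n_m_sum_n (G := R_AbelianGroup) (fun i => f i x) n m Hm).
    apply Rle_lt_trans with (sum_n_m M (S n) m).
    - eapply Rle_trans; [apply (norm_sum_n_m (V := R_NormedModule)) |].
      apply sum_n_m_le; intros k. now apply Hf.
    - eapply Rle_lt_trans; [apply Rle_abs|]. apply (HN (S n) m); lia. }
  intros n m x Hx Hn Hm. destruct (Nat.le_ge_cases n m) as [H|H].
  - rewrite Rabs_minus_sym. now apply Hlt.
  - now apply Hlt.
Qed.

Lemma is_derive_Series (f f' : nat -> R -> R) (M M' : nat -> R) (lo hi : R) :
  (forall i x, lo < x < hi -> is_derive (f i) x (f' i x)) ->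
  (forall i x, lo < x < hi -> continuity_pt (f' i) x) ->
  (forall i x, lo < x < hi -> Rabs (f i x) <= M i) ->
  (forall i x, lo < x < hi -> Rabs (f' i x) <= M' i) ->
  ex_series M -> ex_series M' ->
  forall x, lo < x < hi ->
  is_derive (fun y => Series (fun i => f i y)) x (Series (fun i => f' i x)).
Proof.
  intros Hd Hc Hb Hb' HM HM'.
  set (D := fun x => lo < x < hi).
  assert (Hopen : open D) by (apply open_and; [apply open_gt | apply open_lt]).
  assert (Hsum : forall n x, D x -> is_derive
    (fun y => sum_n (fun i => f i y) n) x (sum_n (fun i => f' i x) n)).
  { intros n x Hx. apply (is_derive_sum_n (V := R_NormedModule)). auto. }
  assert (HD : forall n x, D x ->
    sum_n (fun i => f' i x) n = Derive (fun y => sum_n (fun i => f i y) n) x).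
  { intros n x Hx. symmetry. now apply is_derive_unique, Hsum. }
  intros x Hx. unfold Series.
  rewrite (Lim_seq_ext _ _ (fun n => HD n x Hx)).
  apply (CVU_Derive (fun n y => sum_n (fun i => f i y) n) D); auto.
  - intros y z t Hy Hz Ht. unfold D in *. lra.
  - now apply CVU_dom_series with M.
  - intros n y Hy. eexists. now apply Hsum.
  - intros n y Hy.
    apply continuity_pt_ext_loc with (fun z => sum_n (fun i => f' i z) n).
    + apply (filter_imp D); [now intros; apply HD | now apply Hopen].
    + induction n as [|n IH].
      * apply continuity_pt_ext with (f' 0%nat); [|auto].
        intros z. symmetry. apply (sum_O (G := R_AbelianMonoid)).
      * apply continuity_pt_ext with
          (fun z => sum_n (fun i => f' i z) n + f' (S n) z).
        -- intros z. symmetry. apply (sum_Sn (G := R_AbelianMonoid)).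
        -- apply (continuity_pt_plus _ (f' (S n))); auto.
  - apply CVU_dom_cauchy.
    destruct (CVU_dom_cauchy (fun n y => sum_n (fun i => f' i y) n) D) as [H _].
    intros eps. destruct (H (CVU_dom_series _ _ D Hb' HM') eps) as [N HN].
    exists N. intros n m y Hy Hn Hm. rewrite <- !HD by auto. now apply HN.
Qed.

(** * Convergence *)

Definition inv_1_minus (q : R) (m : nat) : R := / (1 - q ^ m).

Lemma pow_S_bounds (q : R) (i : nat) : 0 < q < 1 -> 0 < q ^ S i <= q.
Proof.
  intros Hq. split; [apply pow_lt; lra|].
  assert (q ^ i <= 1) by (rewrite <- (pow1 i); apply pow_incr; lra).
  simpl. nra.
Qed.

Lemma inv_1_minus_bounds (x q : R) (i : nat) : 0 < x <= q -> q < 1 ->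
  0 < inv_1_minus x (S i) <= / (1 - q).
Proof.
  intros Hx Hq. unfold inv_1_minus.
  destruct (pow_S_bounds x i) as [H1 H2]; [lra|]. split.
  - apply Rinv_0_lt_compat. lra.
  - apply Rinv_le_contravar; lra.
Qed.

(** This is the Cauchy square of the geometric series. *)
Lemma ex_series_linear_geom (x : R) : 0 < x < 1 ->
  ex_series (fun i => INR (S i) * x ^ i).
Proof.
  intros Hx. assert (Hax : Rabs x < 1) by (rewrite Rabs_pos_eq; lra).
  pose proof (is_series_geom x Hax) as Hg.
  assert (Habs : ex_series (fun n => Rabs (x ^ n))).
  { apply (ex_series_ext (fun n => x ^ n)); [|now apply ex_series_geom].
    intros n. rewrite Rabs_pos_eq; [easy | apply pow_le; lra]. }
  eexists. eapply is_series_ext; [|exact (is_series_mult _ _ _ _ Hg Hg Habs Habs)].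
  intros n. cbv beta. rewrite (sum_eq _ (fun _ => x ^ n)).
  - rewrite sum_cte. ring_R.
  - intros k Hk. rewrite <- pow_add. f_equal. lia.
Qed.

Lemma ex_series_dominated (f : nat -> R) (K x : R) : 0 < x < 1 ->
  (forall i, Rabs (f i) <= K * (INR (S i) * x ^ i)) -> ex_series f.
Proof.
  intros Hx Hf.
  apply (ex_series_le (V := R_CompleteNormedModule) f _ Hf).
  apply (ex_series_scal_l (V := R_NormedModule) K).
  now apply ex_series_linear_geom.
Qed.

(** Terms are indexed by [i = m_1 - 1], as in [zbar]. *)
Definition zbar1_term (n : nat) (q : R) (i : nat) : R :=
  q ^ S i * inv_1_minus q (S i) ^ n.

Definition zbar2_term (n r : nat) (q : R) (i : nat) : R :=
  q ^ S i * inv_1_minus q (S i) ^ n * sum_n_m (fun j => inv_1_minus q j ^ r) 1 i.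

Lemma zbar1_term_bound (n : nat) (x q : R) (i : nat) : 0 < x <= q -> q < 1 ->
  0 <= zbar1_term n x i <= (/ (1 - q)) ^ n * (INR (S i) * q ^ i).
Proof.
  intros Hx Hq. destruct (inv_1_minus_bounds x q i Hx Hq) as [H1 H2].
  unfold zbar1_term.
  assert (0 <= x ^ S i) by (apply pow_le; lra).
  assert (0 <= inv_1_minus x (S i) ^ n) by (apply pow_le; lra).
  split; [now apply Rmult_le_pos|].
  rewrite Rmult_comm. apply Rmult_le_compat; auto.
  - apply pow_incr; lra.
  - apply Rle_trans with (1 * q ^ i).
    + simpl. apply Rmult_le_compat; try lra; [apply pow_le; lra|].
      apply pow_incr; lra.
    + apply Rmult_le_compat_r; [apply pow_le; lra|].
      rewrite S_INR. pose proof (pos_INR i). lra.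
Qed.

Lemma ex_series_zbar1 (n : nat) (q : R) : 0 < q < 1 ->
  ex_series (fun i => Rabs (zbar1_term n q i)).
Proof.
  intros Hq. apply ex_series_dominated with ((/ (1 - q)) ^ n) q; [easy|].
  intros i. rewrite Rabs_Rabsolu.
  destruct (zbar1_term_bound n q q i) as [H1 H2]; [lra..|].
  now rewrite Rabs_pos_eq.
Qed.

Lemma is_series_zbar1 (n : nat) (q : R) : 0 < q < 1 ->
  is_series (zbar1_term n q) (zbar n nil q).
Proof.
  intros Hq. unfold zbar.
  rewrite (Series_ext _ (zbar1_term n q)).
  - apply Series_correct, ex_series_Rabs. now apply ex_series_zbar1.
  - intros i. unfold zbar1_term, inv_1_minus. cbn -[pow].
    rewrite pow_inv. unfold Rdiv. ring.
Qed.

Lemma is_series_zbar2 (n r : nat) (q : R) : 0 < q < 1 ->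
  is_series (zbar2_term n r q) (zbar n (cons r nil) q).
Proof.
  intros Hq. unfold zbar. rewrite (Series_ext _ (zbar2_term n r q)).
  - apply Series_correct.
    apply ex_series_dominated with ((/ (1 - q)) ^ n * (/ (1 - q)) ^ r) q; [easy|].
    intros i. destruct (inv_1_minus_bounds q q i) as [H1 H2]; [lra..|].
    set (K := / (1 - q)) in *.
    assert (HS : 0 <= sum_n_m (fun j => inv_1_minus q j ^ r) 1 i <= INR (S i) * K ^ r).
    { rewrite S_INR. induction i as [|i IH].
      - rewrite sum_n_m_empty by lia. simpl.
        assert (0 <= K ^ r) by (apply pow_le; lra). lra.
      - rewrite sum_n_m_last by lia.
        destruct (inv_1_minus_bounds q q i) as [H3 H4]; [lra..|].
        destruct (inv_1_minus_bounds q q (S i)) as [H5 H6]; [lra..|].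
        destruct IH as [IH1 IH2]; auto.
        assert (0 <= inv_1_minus q (S i) ^ r) by (apply pow_le; lra).
        assert (inv_1_minus q (S i) ^ r <= K ^ r) by (apply pow_incr; fold K in H4; lra).
        rewrite S_INR. lra. }
    unfold zbar2_term. destruct HS as [HS1 HS2].
    assert (0 <= inv_1_minus q (S i) ^ n) by (apply pow_le; lra).
    assert (0 <= q ^ S i) by (apply pow_le; lra).
    assert (q ^ S i <= q ^ i).
    { assert (0 <= q ^ i) by (apply pow_le; lra). simpl. nra. }
    rewrite Rabs_pos_eq by (apply Rmult_le_pos; [apply Rmult_le_pos|]; auto).
    replace (K ^ n * K ^ r * (INR (S i) * q ^ i)) with
      (q ^ i * K ^ n * (INR (S i) * K ^ r)) by ring.
    apply Rmult_le_compat; auto; [now apply Rmult_le_pos|].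
    apply Rmult_le_compat; auto. apply pow_incr; lra.
  - intros i. unfold zbar2_term, inv_1_minus.
    cbn -[pow sum_n_m]. rewrite pow_inv. unfold Rdiv. rewrite Nat.sub_0_r.
    f_equal. apply sum_n_m_ext; intros j. rewrite pow_inv. ring_R.
Qed.

(** With [x = q^m] and [w = 1/(1 - x)], one has [x w^(n+1) = w^(n+1) - w^n],
    which turns [q d/dq (x w^n) = m x (w^n + n x w^(n+1))] into the form below. *)
Definition qderiv_term (n : nat) (q : R) (i : nat) : R :=
  INR (S i) * q ^ S i *
  ((1 - INR n) * inv_1_minus q (S i) ^ n + INR n * inv_1_minus q (S i) ^ S n).

(** The derivative may be taken termwise on [(0, r)] with [q < r < 1]: there the
    terms and their derivatives are bounded by multiples of [m r^(m-1)]. *)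
Lemma is_series_qderiv (n : nat) (q : R) : 0 < q < 1 ->
  is_series (qderiv_term n q) (qderiv (zbar n nil) q).
Proof.
  intros Hq. set (r := (1 + q) / 2).
  assert (Hr : q < r < 1) by (unfold r; lra).
  set (f' := fun i x => INR (S i) * x ^ i *
    ((1 - INR n) * inv_1_minus x (S i) ^ n + INR n * inv_1_minus x (S i) ^ S n)).
  set (K := / (1 - r)).
  assert (Hb' : forall i x, 0 < x < r ->
    Rabs (f' i x) <= ((1 + INR n) * K ^ n + INR n * K ^ S n) * (INR (S i) * r ^ i)).
  { intros i x Hx. destruct (inv_1_minus_bounds x r i) as [H1 H2]; [lra..|].
    fold K in H2. set (u := inv_1_minus x (S i)) in *.
    assert (0 <= u ^ n <= K ^ n) by (split; [apply pow_le | apply pow_incr]; lra).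
    assert (0 <= u ^ S n <= K ^ S n) by (split; [apply pow_le | apply pow_incr]; lra).
    assert (0 <= x ^ i <= r ^ i) by (split; [apply pow_le | apply pow_incr]; lra).
    pose proof (pos_INR n). pose proof (pos_INR (S i)).
    unfold f'. fold u. rewrite Rabs_mult, Rmult_comm.
    apply Rmult_le_compat; try apply Rabs_pos.
    - eapply Rle_trans; [apply Rabs_triang|]. apply Rplus_le_compat.
      + rewrite Rabs_mult, (Rabs_pos_eq (u ^ n)) by lra.
        apply Rmult_le_compat; try lra; [apply Rabs_pos|].
        apply Rabs_le; lra.
      + rewrite Rabs_pos_eq; [apply Rmult_le_compat; lra|].
        apply Rmult_le_pos; lra.
    - rewrite Rabs_pos_eq by (apply Rmult_le_pos; lra).
      apply Rmult_le_compat_l; lra. }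
  assert (Hser : ex_series (fun i => INR (S i) * r ^ i))
    by (apply ex_series_linear_geom; lra).
  assert (HD : is_derive (zbar n nil) q (Series (fun i => f' i q))).
  { unfold zbar. apply (is_derive_Series
      (fun i x => let m := S i in x ^ m / (1 - x ^ m) ^ n * zbar_trunc nil x m) f'
      (fun i => K ^ n * (INR (S i) * r ^ i))
      (fun i => ((1 + INR n) * K ^ n + INR n * K ^ S n) * (INR (S i) * r ^ i)) 0 r).
    - intros i x Hx. cbv zeta. cbn [zbar_trunc].
      destruct (pow_S_bounds x i) as [H1 H2]; [lra|].
      assert (Hne : (1 - x ^ S i) <> 0) by lra.
      unfold f', inv_1_minus. rewrite !pow_inv.
      auto_derive.
      + now apply pow_nonzero.
      + change (match i with 0%nat => 1 | S _ => INR i + 1 end) with (INR (S i)).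
        simpl (x ^ S i) in *. destruct n as [|n].
        * simpl. field. exact Hne.
        * simpl (Init.Nat.pred _). rewrite (S_INR n). simpl (_ ^ S _).
          eq_R.
          change (1 + - (x * x ^ i)) with (1 - x * x ^ i).
          set (d := 1 - x * x ^ i) in *.
          replace (x * x ^ i) with (1 - d) by (unfold d; ring).
          field. split; [now apply pow_nonzero | exact Hne].
    - intros i x Hx.
      destruct (pow_S_bounds x i) as [H1 H2]; [lra|].
      assert (Hne : (1 - x ^ S i) <> 0) by lra.
      apply derivable_continuous_pt, ex_derive_Reals_0.
      unfold f', inv_1_minus. auto_derive. tauto.
    - intros i x Hx. destruct (zbar1_term_bound n x r i) as [H1 H2]; [lra..|].
      change (Rabs (x ^ S i / (1 - x ^ S i) ^ n * 1) <= K ^ n * (INR (S i) * r ^ i)).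
      replace (x ^ S i / (1 - x ^ S i) ^ n * 1) with (zbar1_term n x i).
      + rewrite Rabs_pos_eq; auto.
      + unfold zbar1_term, inv_1_minus. rewrite pow_inv. unfold Rdiv. ring.
    - exact Hb'.
    - now apply (ex_series_scal_l (V := R_NormedModule)).
    - now apply (ex_series_scal_l (V := R_NormedModule)).
    - lra. }
  unfold qderiv. rewrite (is_derive_unique _ _ _ HD).
  apply (is_series_ext (fun i => q * f' i q)).
  - intros i. unfold f', qderiv_term. simpl (q ^ S i). ring_R.
  - apply (is_series_scal_l (V := R_NormedModule) q). apply Series_correct.
    eapply ex_series_dominated with (x := r); [lra|].
    intros i. apply Hb'. lra.
Qed.

(** * The double sum *)

(** The Cauchy product starts at [m_1 = 2]; the term [m_1 = 1] has an empty
    inner sum. *)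
Lemma is_series_product (a b : nat) (q : R) : 0 < q < 1 ->
  is_series (fun i => q ^ S i *
      sum_n_m (fun j => inv_1_minus q j ^ a * inv_1_minus q (S i - j) ^ b) 1 i)
    (zbar a nil q * zbar b nil q).
Proof.
  intros Hq.
  pose proof (is_series_mult _ _ _ _ (is_series_zbar1 a q Hq)
    (is_series_zbar1 b q Hq) (ex_series_zbar1 a q Hq) (ex_series_zbar1 b q Hq)) as H.
  apply (is_series_decr_1 (V := R_NormedModule)).
  rewrite (sum_n_m_empty _ 1 0) by lia.
  match goal with |- is_series _ ?l =>
    replace l with (zbar a nil q * zbar b nil q) end.
  2:{ change (zbar a nil q * zbar b nil q =
        zbar a nil q * zbar b nil q + - (q ^ 1 * 0)). ring. }
  eapply is_series_ext; [|exact H].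
  intros N. cbv beta. rewrite <- sum_n_Reals. unfold sum_n.
  rewrite sum_n_m_shift, sum_n_m_scal_R.
  apply sum_n_m_ext_in; intros k Hk. unfold zbar1_term.
  replace (S (S N) - S k)%nat with (S (N - k)) by lia.
  replace (q ^ S (S N)) with (q ^ S k * q ^ S (N - k))
    by (rewrite <- pow_add; f_equal; lia).
  ring_R.
Qed.

Lemma is_series_sum_n_m (f : nat -> nat -> R) (s : nat -> R) (n m : nat) :
  (forall k, (n <= k <= m)%nat -> is_series (f k) (s k)) ->
  is_series (fun i => sum_n_m (fun k => f k i) n m) (sum_n_m s n m).
Proof.
  assert (H0 : is_series (fun _ : nat => 0) 0).
  { pose proof (is_series_geom 0) as H. rewrite Rabs_R0 in H.
    specialize (H Rlt_0_1). apply (is_series_scal_r 0) in H.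
    rewrite Rmult_0_r in H. eapply is_series_ext; [|exact H].
    intros; simpl; ring_R. }
  induction m as [|m IH]; intros H.
  - destruct n.
    + rewrite sum_n_n. eapply is_series_ext; [|apply H; lia].
      intros; now rewrite sum_n_n.
    + rewrite sum_n_m_empty by lia. eapply is_series_ext; [|exact H0].
      intros; now rewrite sum_n_m_empty by lia.
  - destruct (Nat.le_gt_cases n (S m)) as [Hn|Hn].
    + rewrite sum_n_m_last by lia.
      eapply is_series_ext; [|apply (is_series_plus (V := R_NormedModule));
        [apply IH; intros; apply H; lia | apply H; lia]].
      intros; now rewrite sum_n_m_last by lia.
    + rewrite sum_n_m_empty by lia. eapply is_series_ext; [|exact H0].
      intros; now rewrite sum_n_m_empty by lia.
Qed.

(** [zbar2_term s r] is [q^(m_1)] times the sum over [m < m_1] of [w^s u^r]. *)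
Lemma is_series_polar (a b : nat) (q : R) : (1 <= a)%nat -> 0 < q < 1 ->
  is_series (fun i => q ^ S i *
      sum_n_m (fun j => polar (inv_1_minus q j) (inv_1_minus q (S i)) a b) 1 i)
    (sum_n_m (fun l =>
      sum_n_m (fun k =>
        (-1) ^ k * choose (l + b - 1) l * choose b k
          * zbar (b + l) (cons (a - l - k)%nat nil) q)
        0 (Nat.min b (a - 1 - l))) 0 (a - 1)).
Proof.
  intros Ha Hq. eapply is_series_ext; [|
    apply is_series_sum_n_m; intros l _;
    apply is_series_sum_n_m; intros k _;
    apply (is_series_scal_l (V := R_NormedModule));
    now apply is_series_zbar2].
  intros i. cbv beta.
  rewrite (sum_n_m_ext_in (fun j => polar _ _ _ _) _ 1 i
    (fun j _ => polar_expand _ _ a b Ha)).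
  rewrite sum_n_m_exchange, sum_n_m_scal_R.
  apply sum_n_m_ext_in; intros l _.
  rewrite sum_n_m_exchange, sum_n_m_scal_R.
  apply sum_n_m_ext_in; intros k _.
  rewrite <- (sum_n_m_scal_R ((-1) ^ k * choose (l + b - 1) l * choose b k)).
  rewrite <- (sum_n_m_scal_R (inv_1_minus q (S i) ^ (b + l))).
  unfold zbar2_term.
  change (@scal R_AbsRing R_NormedModule) with Rmult. ring_R.
Qed.

Lemma choose_binom_sym (l b : nat) : (1 <= b)%nat ->
  choose (l + b - 1) l = binom (l + b - 1) (b - 1).
Proof.
  intros Hb. rewrite choose_binom by lia. unfold binom.
  rewrite pascal_step1 by lia. f_equal. lia.
Qed.

Theorem mainTheorem1 (a b : nat) (q : R)
    (Ha : (1 < a)%nat) (Hab : (a <= b)%nat) (Hq : 0 < q < 1) :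
  zbar a nil q * zbar b nil q =
    sum_n_m (fun l =>
      sum_n_m (fun k =>
        (-1) ^ k * binom (l + b - 1) (b - 1) * binom b k
          * zbar (b + l) (cons (a - l - k)%nat nil) q)
        0 (a - 1 - l)) 0 (a - 1)
  + sum_n_m (fun l =>
      sum_n_m (fun k =>
        (-1) ^ k * binom (l + a - 1) (a - 1) * binom a k
          * zbar (a + l) (cons (b - l - k)%nat nil) q)
        0 (Nat.min a (b - 1 - l))) 0 (b - 1)
  - sum_n_m (fun k => beta a b (a - k) * zbar (a + b - k) nil q) 1 a
  + sum_n_m (fun j =>
      alpha a b (a + b - 1 - j) * qderiv (zbar (a + b - 1 - j) nil) q)
      1 (a - 1).
Proof.
  assert (HP : forall a b, (1 <= a)%nat -> (1 <= b)%nat ->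
    is_series (fun i => q ^ S i *
      sum_n_m (fun j => polar (inv_1_minus q j) (inv_1_minus q (S i)) a b) 1 i)
    (sum_n_m (fun l =>
      sum_n_m (fun k =>
        (-1) ^ k * binom (l + b - 1) (b - 1) * binom b k
          * zbar (b + l) (cons (a - l - k)%nat nil) q)
        0 (Nat.min b (a - 1 - l))) 0 (a - 1))).
  { clear a b Ha Hab. intros a b Ha Hb.
    pose proof (is_series_polar a b q Ha Hq) as H.
    erewrite sum_n_m_ext_in; [exact H|]. intros l _.
    apply sum_n_m_ext_in; intros k Hk. cbv beta.
    now rewrite choose_binom_sym, choose_binom by lia. }
  pose proof (is_series_product a b q Hq) as Hprod.
  pose proof (HP a b ltac:(lia) ltac:(lia)) as H1.
  pose proof (HP b a ltac:(lia) ltac:(lia)) as H2.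
  rewrite (sum_n_m_ext_in (fun l => sum_n_m _ 0 (Nat.min b (a - 1 - l))) (fun l =>
      sum_n_m (fun k =>
        (-1) ^ k * binom (l + b - 1) (b - 1) * binom b k
          * zbar (b + l) (cons (a - l - k)%nat nil) q)
        0 (a - 1 - l))) in H1
    by (intros; now rewrite Nat.min_r by lia).
  assert (H3 : is_series
    (fun i => sum_n_m (fun k => beta a b (a - k) * zbar1_term (a + b - k) q i) 1 a)
    (sum_n_m (fun k => beta a b (a - k) * zbar (a + b - k) nil q) 1 a)).
  { apply is_series_sum_n_m; intros k _.
    apply (is_series_scal_l (V := R_NormedModule)). now apply is_series_zbar1. }
  assert (H4 : is_series
    (fun i => sum_n_m (fun j =>
      alpha a b (a + b - 1 - j) * qderiv_term (a + b - 1 - j) q i) 1 (a - 1))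
    (sum_n_m (fun j =>
      alpha a b (a + b - 1 - j) * qderiv (zbar (a + b - 1 - j) nil) q) 1 (a - 1))).
  { apply is_series_sum_n_m; intros k _.
    apply (is_series_scal_l (V := R_NormedModule)). now apply is_series_qderiv. }
  pose proof (is_series_plus (V := R_NormedModule) _ _ _ _
    (is_series_minus (V := R_NormedModule) _ _ _ _
      (is_series_plus (V := R_NormedModule) _ _ _ _ H1 H2) H3) H4) as Hsum.
  rewrite <- (is_series_unique _ _ Hprod).
  apply is_series_unique.
  eapply is_series_ext; [|exact Hsum].
  intros i. cbv beta. clear H1 H2 H3 H4 Hprod Hsum HP.
  change (@plus R_NormedModule) with Rplus. change (@opp R_NormedModule) with Ropp.
  set (w := inv_1_minus q (S i)).
  (* Sum the decomposition over the [i = m_1 - 1] splittings [m_1 = j + (m_1 - j)]. *)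
  assert (Hpf : sum_n_m
      (fun j => inv_1_minus q j ^ a * inv_1_minus q (S i - j) ^ b) 1 i =
    sum_n_m (fun j => polar (inv_1_minus q j) w a b) 1 i
    + sum_n_m (fun j => polar (inv_1_minus q j) w b a) 1 i
    + INR i * w_part w a b).
  { transitivity (sum_n_m (fun j => polar (inv_1_minus q j) w a b) 1 i
      + sum_n_m (fun j => polar (inv_1_minus q (S i - j)) w b a) 1 i
      + sum_n_m (fun _ => w_part w a b) 1 i).
    - rewrite !sum_n_m_plus_R. apply sum_n_m_ext_in; intros j Hj.
      apply partial_fractions. unfold w, inv_1_minus.
      replace (q ^ S i) with (q ^ j * q ^ (S i - j))
        by (rewrite <- pow_add; f_equal; lia).
      destruct (pow_S_bounds q (j - 1) Hq) as [_ Hx].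
      destruct (pow_S_bounds q (i - j) Hq) as [_ Hy].
      destruct (pow_S_bounds q i Hq) as [_ Hz].
      replace (S (j - 1)) with j in Hx by lia.
      replace (S (i - j)) with (S i - j)%nat in Hy by lia.
      replace (q ^ S i) with (q ^ j * q ^ (S i - j)) in Hz
        by (rewrite <- pow_add; f_equal; lia).
      field. lra.
    - f_equal; [f_equal|].
      + destruct i as [|i]; [now rewrite !sum_n_m_empty by lia|].
        rewrite !sum_n_m_shift, sum_n_m_reverse. apply sum_n_m_ext_in; intros j Hj.
        do 2 f_equal. lia.
      + rewrite sum_n_m_const. f_equal. f_equal. lia. }
  rewrite Hpf, w_part_beta by lia.
  assert (Hz : sum_n_m (fun k => beta a b (a - k) * zbar1_term (a + b - k) q i) 1 a
    = q ^ S i * sum_n_m (fun k => beta a b (a - k) * w ^ (a + b - k)) 1 a).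
  { rewrite sum_n_m_scal_R. apply sum_n_m_ext_in; intros k _.
    unfold zbar1_term. fold w. ring_R. }
  assert (Hd : sum_n_m (fun j =>
      alpha a b (a + b - 1 - j) * qderiv_term (a + b - 1 - j) q i) 1 (a - 1)
    = INR (S i) * q ^ S i *
      sum_n_m (fun k => beta a b (a - k) * w ^ (a + b - k)) 1 a).
  { rewrite <- alpha_beta_sum, sum_n_m_scal_R by lia.
    apply sum_n_m_ext_in; intros k _. unfold qderiv_term. fold w. ring_R. }
  rewrite Hz, Hd, S_INR. ring_R.
Qed.
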